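(* Let $\mathbf{f}\in L^\infty(0,T;H^{-1}(\Omega))$ and let $(\mathbf{u}_h^{n})$ be the velocity part of a solution of the SAV-BDF2LE algorithm described in the context. Then for any $\Delta t>0$ and $N\ge 1$, $$\|\mathbf{u}_h^N\|^2+\|2\mathbf{u}_h^N-\mathbf{u}_h^{N-1}\|^2+2\Delta t\sum_{n=1}^{N-1}\big(\nu\|\nabla\mathbf{u}_h^{n+1}\|^2+2\alpha_2\|\nabla\cdot\mathbf{u}_h^{n+1}\|^2\big)+2\alpha_1\Delta t\|\nabla\times\mathbf{u}_h^N\|^2$$ $$\le \|\mathbf{u}_h^1\|^2+\|2\mathbf{u}_h^1-\mathbf{u}_h^0\|^2+2\alpha_1\Delta t\|\nabla\times\mathbf{u}_h^1\|^2+2\Delta t\sum_{n=1}^{N-1}\nu^{-1}\|\mathbf{f}(t^{n+1})\|_{-1}^2.$$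
   Context: $\Omega\subset\mathbb{R}^d$, $d\in\{2,3\}$, is an open regular (bounded) domain; $(\cdot,\cdot)$ and $\|\cdot\|$ are the $L^2(\Omega)$ inner product and norm (also used for the pairing of $\mathbf{f}$ with elements of $\mathbf{X}$). $\mathbf{X}=(H_0^1(\Omega))^d$, $Q=L_0^2(\Omega)$ (mean-zero $L^2$ functions). $H^{-1}$ is the dual of $\mathbf{X}$ with norm $\|\mathbf{f}\|_{-1}=\sup_{0\ne\mathbf{v}\in\mathbf{X}}\frac{|(\mathbf{f},\mathbf{v})|}{\|\nabla\mathbf{v}\|}$. $\mathbf{X}_h\subset\mathbf{X}$, $Q_h\subset Q$ are conforming finite element spaces satisfying the discrete inf-sup condition $\inf_{q_h\in Q_h}\sup_{\mathbf{v}_h\in \mathbf{X}_h}\frac{(q_h,\nabla\cdot\mathbf{v}_h)}{\|\nabla\mathbf{v}_h\|\,\|q_h\|}\ge\beta>0$ with $\beta$ independent of $h$. $L_H\subset L^2(\Omega)^d$ is the finite-dimensional large scale space containing the variable $S_H$; for $d=2$ the curl $\nabla\times\mathbf{v}=\partial_x v_2-\partial_y v_1$ is scalar and $L_H$ is understood as a space of scalar $L^2$ functions. The constants $\nu>0$ (viscosity), $\alpha_1>0$ (artificial viscosity) and $\alpha_2>0$ (grad-div parameter) are given. The skew-symmetric trilinear form is $b(\mathbf{u},\mathbf{v},\mathbf{w})=\frac12\big((\mathbf{u}\cdot\nabla\mathbf{v},\mathbf{w})-(\mathbf{u}\cdot\nabla\mathbf{w},\mathbf{v})\big)$. For a final time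 $T>0$ and number of steps $N$, $\Delta t=T/N$ and $t^n=n\Delta t$. The values $\mathbf{f}(t^{n})$ are assumed well defined in $H^{-1}$. SAV-BDF2LE algorithm: given initial velocity $\mathbf{u}_0$, let $\mathbf{u}_h^0,\mathbf{u}_h^{-1}\in\mathbf{X}_h$ be the nodal interpolants of $\mathbf{u}_0$. Given $\mathbf{u}_h^n,\mathbf{u}_h^{n-1}$, find $(\mathbf{u}_h^{n+1},p_h^{n+1},S_H^{n+1})\in \mathbf{X}_h\times Q_h\times L_H$ such that for all $(\mathbf{v}_h,q_h,l_H)\in \mathbf{X}_h\times Q_h\times L_H$: $$\Big(\tfrac{3\mathbf{u}_h^{n+1}-4\mathbf{u}_h^n+\mathbf{u}_h^{n-1}}{2\Delta t},\mathbf{v}_h\Big)+\nu(\nabla\mathbf{u}_h^{n+1},\nabla\mathbf{v}_h)+b(2\mathbf{u}_h^n-\mathbf{u}_h^{n-1},\mathbf{u}_h^{n+1},\mathbf{v}_h)-(p_h^{n+1},\nabla\cdot\mathbf{v}_h)$$ $$+\alpha_1(\nabla\times\mathbf{u}_h^{n+1},\nabla\times\mathbf{v}_h)-\alpha_1(S_H^{n+1},\nabla\times\mathbf{v}_h)+\alpha_2(\nabla\cdot\mathbf{u}_h^{n+1},\nabla\cdot\mathbf{v}_h)=(\mathbf{f}(t^{n+1}),\mathbf{v}_h),$$ $$(\nabla\cdot\mathbf{u}_h^{n+1},q_h)=0,\qquad (S_H^{n+1}-\nabla\times\mathbf{u}_h^n,l_H)=0.$$ *)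

(* Defs.v *)
From HB Require Import structures.
From mathcomp Require Import all_boot all_order all_algebra.
From mathcomp Require Import all_classical all_reals all_analysis.
Set Implicit Arguments.
Unset Strict Implicit.
Unset Printing Implicit Defensive.
Import Order.TTheory GRing.Theory Num.Theory.
Import numFieldNormedType.Exports.
Local Open Scope classical_set_scope.
Local Open Scope ring_scope.

(* The product (= Borel) sigma-algebra on R^n, as for n.-tuples in the library. *)
Definition rV_display : Type -> measure_display.
Proof. exact. Qed.

Section measurable_rV.
Variables (R : realType) (n : nat).

Let coord (i : 'I_n) (x : 'rV[R]_n) : measurableTypeR R := x 0 i.

Let rV_set0 : g_sigma_preimage coord set0.
Proof. exact: sigma_algebra0. Qed.

Let rV_setC A : g_sigma_preimage coord A -> g_sigma_preimage coord (~` A).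
Proof. exact: sigma_algebraC. Qed.

Let rV_bigcup (F : (set 'rV[R]_n)^nat) :
  (forall i, g_sigma_preimage coord (F i)) ->
  g_sigma_preimage coord (\bigcup_i F i).
Proof. exact: sigma_algebra_bigcup. Qed.

HB.instance Definition _ := @isMeasurable.Build
  (rV_display R) 'rV[R]_n
  (g_sigma_preimage coord) rV_set0 rV_setC rV_bigcup.

Lemma measurable_coord (i : 'I_n) :
  measurable_fun [set: 'rV[R]_n] (fun x => x 0 i : measurableTypeR R).
Proof.
move=> _ Y mY; rewrite setTI; apply: sub_sigma_algebra => /=.
rewrite -bigcup_seq/=; exists i => /=; first by rewrite mem_index_enum.
by exists Y => //; rewrite setTI.
Qed.

Lemma measurable_fun_rVP d (T : measurableType d) (f : T -> 'rV[R]_n) :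
  (forall i, measurable_fun setT (fun x => f x 0 i : measurableTypeR R)) ->
  measurable_fun setT f.
Proof.
move=> mf; apply: (@measurability _ _ _ _ setT f
  (\big[setU/set0]_(i < n) preimage_set_system setT (coord i) measurable)) => //.
move=> _ [B + <-]; rewrite -bigcup_seq => -[i _ [C mC <-]].
rewrite -comp_preimage//. have := mf i measurableT C mC; rewrite setTI//.
by rewrite setTI setTI comp_preimage.
Qed.

End measurable_rV.

Section lebesgue.
Variable R : realType.

Definition rV_cons n (p : measurableTypeR R * 'rV[R]_n) : 'rV[R]_n.+1 :=
  \row_i (if unlift ord0 i is Some j then p.2 0 j else p.1).

Definition rV_uncons n (x : 'rV[R]_n.+1) : measurableTypeR R * 'rV[R]_n :=
  (x 0 ord0, \row_j x 0 (lift ord0 j)).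

Lemma rV_consK n : cancel (@rV_cons n) (@rV_uncons n).
Proof.
move=> [a x]; rewrite /rV_uncons /rV_cons !mxE unlift_none; congr pair.
by apply/rowP => j; rewrite !mxE liftK.
Qed.

Lemma measurable_rV_cons n : measurable_fun setT (@rV_cons n).
Proof.
apply: measurable_fun_rVP => i.
rewrite (_ : (fun _ => _) = fun p : measurableTypeR R * 'rV[R]_n =>
  if unlift ord0 i is Some j then p.2 0 j else p.1); last first.
  by apply/funext => p; rewrite mxE.
case: (unlift ord0 i) => [j|]; last exact: measurable_fst.
exact: (measurableT_comp (measurable_coord j) measurable_snd).
Qed.

Lemma measurable_rV_uncons n : measurable_fun setT (@rV_uncons n).
Proof.
apply: measurable_fun_pair; first exact: measurable_coord.
apply: measurable_fun_rVP => i.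
rewrite (_ : (fun _ => _) = fun x : 'rV[R]_n.+1 => x 0 (lift ord0 i)); last first.
  by apply/funext => x; rewrite mxE.
exact: measurable_coord.
Qed.

Section step.
Variables (n : nat) (mu : {sigma_finite_measure set 'rV[R]_n -> \bar R}).

Definition lebesgue_step : set 'rV[R]_n.+1 -> \bar R :=
  pushforward (lebesgue_measure \x mu)%E (@rV_cons n).

Let mcons := @measurable_rV_cons n.

Let preim_cons (A : set 'rV[R]_n.+1) :
  measurable A -> measurable (@rV_cons n @^-1` A).
Proof. by move=> mA; rewrite -[X in measurable X]setTI; exact: mcons. Qed.

Let step0 : lebesgue_step set0 = 0%E.
Proof. by rewrite /lebesgue_step /pushforward preimage_set0 measure0. Qed.

Let step_ge0 A : (0 <= lebesgue_step A)%E.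
Proof. exact: measure_ge0. Qed.

Let step_sigma_additive : semi_sigma_additive lebesgue_step.
Proof.
move=> F mF tF mUF; rewrite /lebesgue_step /pushforward preimage_bigcup.
apply: measure_semi_sigma_additive.
- by move=> k; exact: preim_cons.
- apply/trivIsetP => /= i j _ _ ij; rewrite -preimage_setI.
  by move/trivIsetP : tF => /(_ _ _ _ _ ij) ->//; rewrite preimage_set0.
- by rewrite -preimage_bigcup; exact: preim_cons.
Qed.

HB.instance Definition _ := isMeasure.Build _ _ _
  lebesgue_step step0 step_ge0 step_sigma_additive.

Let step_sigma_finite : sigma_finite setT lebesgue_step.
Proof.
have /sigma_finiteP[F [TF ndF Foo]] := sigma_finiteT (@lebesgue_measure R).
have /sigma_finiteP[G [TG ndG Goo]] := sigma_finiteT mu.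
exists (fun k => @rV_uncons n @^-1` (F k `*` G k)).
  apply/esym; rewrite -subTset => x _.
  have [k _ Fk] : (\bigcup_k F k) (rV_uncons x).1 by rewrite -TF.
  have [l _ Gl] : (\bigcup_k G k) (rV_uncons x).2 by rewrite -TG.
  exists (maxn k l) => //; split.
    by move: (rV_uncons x).1 Fk; exact/subsetPset/ndF/leq_maxl.
  by move: (rV_uncons x).2 Gl; exact/subsetPset/ndG/leq_maxr.
move=> k; have [mF Fk] := Foo k; have [mG Gk] := Goo k; split.
  rewrite -[X in measurable X]setTI; apply: measurable_rV_uncons => //.
  exact: measurableX.
rewrite /lebesgue_step /pushforward -comp_preimage.
rewrite (_ : _ \o _ = id); last by apply/funext => p; exact: rV_consK.
by rewrite preimage_id product_measure1E// lte_mul_pinfty// ge0_fin_numE.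
Qed.

HB.instance Definition _ := @Measure_isSigmaFinite.Build _ _ _
  lebesgue_step step_sigma_finite.

End step.

(* n-dimensional Lebesgue measure, iterating the binary product measure. *)
Fixpoint lebesgue_rV n : {sigma_finite_measure set 'rV[R]_n -> \bar R} :=
  match n with
  | 0 => [the {sigma_finite_measure set _ -> \bar R} of dirac (0 : 'rV[R]_0)]
  | m.+1 => [the {sigma_finite_measure set _ -> \bar R} of
      lebesgue_step (lebesgue_rV m)]
  end.

End lebesgue.

Arguments lebesgue_rV R n : clear implicits.

Section sobolev.
Variables (R : realType) (d : nat).
Local Notation E := 'rV[R]_d.
Local Notation mu := (lebesgue_rV R d).
Implicit Types (Omega : set E) (phi : E -> R).

(* Near each boundary point Omega is the strict epigraph, in some unit
   direction e, of a Lipschitz function gamma of the variables orthogonal to e. *)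
Definition lipschitz_boundary Omega :=
  forall x, closure Omega x -> ~ Omega x ->
  exists r (e : E) (gamma : E -> R) k,
    [/\ 0 < r, \sum_i e 0 i ^+ 2 = 1, k.-lipschitz gamma,
        (forall y s, gamma (y + s *: e) = gamma y)
      & forall y, ball x r y -> (Omega y <-> gamma y < \sum_i y 0 i * e 0 i)].

Definition regular_domain Omega :=
  [/\ Omega !=set0, open Omega, connected Omega, bounded_set Omega
    & lipschitz_boundary Omega].

(* Functions on Omega are represented by total functions on R^d whose values
   outside Omega are irrelevant; equality in L^2 is equality a.e. on Omega. *)
Definition nonzero_on Omega (V : zmodType) (F : E -> V) :=
  ~ {ae mu, forall x, Omega x -> F x = 0}.

Definition L2 Omega (f : E -> R) :=
  measurable_fun Omega f /\ mu.-integrable Omega (fun x => (f x ^+ 2)%:E).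

Definition L2ip Omega (f g : E -> R) : R := \int[mu]_(x in Omega) (f x * g x).

Definition L2norm Omega (f : E -> R) : R := Num.sqrt (L2ip Omega f f).

Definition L2_mx Omega m n (F : E -> 'M[R]_(m, n)) :=
  forall i j, L2 Omega (fun x => F x i j).

Definition L2ip_mx Omega m n (F G : E -> 'M[R]_(m, n)) : R :=
  \int[mu]_(x in Omega) (\sum_i \sum_j F x i j * G x i j).

Definition L2norm_mx Omega m n (F : E -> 'M[R]_(m, n)) : R :=
  Num.sqrt (L2ip_mx Omega F F).

Definition partial (i : 'I_d) phi : E -> R := fun x => 'D_(delta_mx 0 i) phi x.

Definition smooth phi :=
  forall s : seq 'I_d, let psi := foldr partial phi s in
    continuous psi /\ forall i x, derivable psi x (delta_mx 0 i).

Definition test_function Omega phi :=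
  smooth phi /\
  exists K : set E, [/\ compact K, K `<=` Omega & forall x, ~ K x -> phi x = 0].

Definition is_weak_partial Omega (i : 'I_d) (u g : E -> R) :=
  L2 Omega g /\ forall phi, test_function Omega phi ->
    L2ip Omega u (partial i phi) = - L2ip Omega g phi.

(* The i-th weak derivative, determined up to a null set when it exists. *)
Definition wpartial Omega (i : 'I_d) (u : E -> R) : E -> R :=
  xget (fun=> 0) [set g | is_weak_partial Omega i u g].

Definition H1 Omega (u : E -> R) :=
  L2 Omega u /\ forall i, exists g, is_weak_partial Omega i u g.

(* The closure of the test functions in the H^1 norm. *)
Definition H10 Omega (u : E -> R) :=
  H1 Omega u /\ exists phi : nat -> E -> R,
    [/\ forall k, test_function Omega (phi k),
        L2norm Omega (fun x => u x - phi k x) @[k --> \oo] --> 0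
      & forall i, L2norm Omega (fun x => wpartial Omega i u x
                                       - partial i (phi k) x) @[k --> \oo] --> 0].

Definition velocity_space Omega : set (E -> E) :=
  [set v | forall j, H10 Omega (fun x => v x 0 j)].

Definition pressure_space Omega : set (E -> R) :=
  [set q | L2 Omega q /\ \int[mu]_(x in Omega) q x = 0].

(* Rows are the directions of derivation: (grad v) i j is the i-th derivative
   of v_j, hence (u . grad) v is the row vector u *m grad v. *)
Definition grad Omega (v : E -> E) : E -> 'M[R]_d :=
  fun x => \matrix_(i, j) wpartial Omega i (fun y => v y 0 j) x.

Definition div Omega (v : E -> E) : E -> R :=
  fun x => \sum_i wpartial Omega i (fun y => v y 0 i) x.

Definition trilinear Omega (u v w : E -> E) : R :=
  2^-1 * (L2ip_mx Omega (fun x => u x *m grad Omega v x) w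
          - L2ip_mx Omega (fun x => u x *m grad Omega w x) v).

(* Elements of H^{-1}: linear forms on (H^1_0)^d, bounded for the norm |grad v|. Only
   their values there matter. *)
Definition dual Omega (F : (E -> E) -> R) :=
  (forall a v w, velocity_space Omega v -> velocity_space Omega w -> F (a *: v + w) = a * F v + F w) /\
  exists C, forall v, velocity_space Omega v -> `|F v| <= C * L2norm_mx Omega (grad Omega v).

Definition dual_norm Omega (F : (E -> E) -> R) : R :=
  sup [set `|F v| / L2norm_mx Omega (grad Omega v) |
       v in [set v | velocity_space Omega v /\ nonzero_on Omega v]].

Definition simple_dual Omega (s : R -> (E -> E) -> R) :=
  [/\ forall t, dual Omega (s t), finite_set (range s)
    & forall F, measurable (s @^-1` [set F])].

Definition strongly_measurable Omega (T : R) (f : R -> (E -> E) -> R) :=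
  exists s : nat -> R -> (E -> E) -> R,
    (forall k, simple_dual Omega (s k)) /\
    {ae lebesgue_measure, forall t, 0 < t < T ->
      dual_norm Omega (fun v => f t v - s k t v) @[k --> \oo] --> 0}.

(* The Bochner space L^oo(0, T; H^{-1}). *)
Definition Linfty_dual Omega (T : R) (f : R -> (E -> E) -> R) :=
  [/\ {ae lebesgue_measure, forall t, 0 < t < T -> dual Omega (f t)},
      strongly_measurable Omega T f
    & exists M, {ae lebesgue_measure, forall t, 0 < t < T ->
        dual_norm Omega (f t) <= M}].

End sobolev.

Definition curl_dim (d : nat) : nat :=
  match d with 2 => 1 | 3 => 3 | _ => 0 end.

(* For d = 2 the scalar curl is a row vector with one entry. For d = 3 the
   indices k + 1 and k + 2 are taken modulo 3. *)
Definition curl (R : realType) (d : nat) :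
    set 'rV[R]_d -> ('rV[R]_d -> 'rV[R]_d) -> 'rV[R]_d -> 'rV[R]_(curl_dim d) :=
  match d return
    set 'rV[R]_d -> ('rV[R]_d -> 'rV[R]_d) -> 'rV[R]_d -> 'rV[R]_(curl_dim d)
  with
  | 2 => fun Omega v x => \row_(k < 1)
           (wpartial Omega (0 : 'I_2) (fun y => v y 0 (1 : 'I_2)) x
            - wpartial Omega (1 : 'I_2) (fun y => v y 0 (0 : 'I_2)) x)
  | 3 => fun Omega v x => \row_(k < 3)
           (wpartial Omega (k + 1 : 'I_3) (fun y => v y 0 (k + 2 : 'I_3)) x
            - wpartial Omega (k + 2 : 'I_3) (fun y => v y 0 (k + 1 : 'I_3)) x)
  | _ => fun _ _ _ => 0
  end.

(* A finite element space, given by a nodal basis and the dual nodal variables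
   (degrees of freedom). A nodal variable such as a point value is a linear form
   on functions; one defined on fewer functions is extended arbitrarily. *)
Record fe_space (R : realType) (V : lmodType R) := FESpace {
  fe_dim : nat;
  fe_basis : 'I_fe_dim -> V;
  fe_node : 'I_fe_dim -> {linear V -> R^o};
  fe_dual : forall i j, fe_node i (fe_basis j) = (i == j)%:R }.

Arguments fe_basis {R V} _ _.
Arguments fe_node {R V} _ _.

Definition fe_set (R : realType) (V : lmodType R) (S : fe_space V) : set V :=
  range (fun c : 'rV[R]_(fe_dim S) => \sum_i c 0 i *: fe_basis S i).

Definition nodal_interpolant (R : realType) (V : lmodType R) (S : fe_space V)
    (v : V) : V := \sum_i (fe_node S i v : R) *: fe_basis S i.

Definition finite_dim_subspace (R : realType) (V : lmodType R) (A : set V) :=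
  exists n (b : 'I_n -> V), A = range (fun c : 'rV[R]_n => \sum_i c 0 i *: b i).

Section scheme.
Variables (R : realType) (d : nat).
Local Notation E := 'rV[R]_d.

(* The discrete inf-sup quotients, in the extended reals because of the infimum
   over a possibly empty set. *)
Definition infsup (Omega : set E) (Xh : set (E -> E)) (Qh : set (E -> R)) :
    \bar R :=
  ereal_inf [set ereal_sup
    [set (L2ip Omega q (div Omega v)
          / (L2norm_mx Omega (grad Omega v) * L2norm Omega q))%:E |
     v in [set v | Xh v /\ nonzero_on Omega v]] |
   q in [set q | Qh q /\ nonzero_on Omega q]].

(* Time levels are integers because of the initial level n = -1. *)
Definition SAV_BDF2LE (Omega : set E) (nu alpha1 alpha2 dt : R) (N : nat)
    (f : R -> (E -> E) -> R) (Xh : fe_space (E -> E)) (Qh : fe_space (E -> R))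
    (LH : set (E -> 'rV[R]_(curl_dim d))) (u0 : E -> E)
    (u : int -> E -> E) (p : int -> E -> R)
    (S : int -> E -> 'rV[R]_(curl_dim d)) :=
  [/\ u 0 = nodal_interpolant Xh u0, u (-1) = nodal_interpolant Xh u0 &
   forall n : nat, (n < N)%N -> let k : int := n%:Z in
   [/\ fe_set Xh (u (k + 1)), fe_set Qh (p (k + 1)), LH (S (k + 1)) &
    [/\ forall v, fe_set Xh v ->
          L2ip_mx Omega
            ((2 * dt)^-1 *: (3 *: u (k + 1) - 4 *: u k + u (k - 1))) v
          + nu * L2ip_mx Omega (grad Omega (u (k + 1))) (grad Omega v)
          + trilinear Omega (2 *: u k - u (k - 1)) (u (k + 1)) v
          - L2ip Omega (p (k + 1)) (div Omega v)
          + alpha1 * L2ip_mx Omega (curl Omega (u (k + 1))) (curl Omega v)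
          - alpha1 * L2ip_mx Omega (S (k + 1)) (curl Omega v)
          + alpha2 * L2ip Omega (div Omega (u (k + 1))) (div Omega v)
          = f (n.+1%:R * dt) v,
        forall q, fe_set Qh q -> L2ip Omega (div Omega (u (k + 1))) q = 0
      & forall l, LH l ->
          L2ip_mx Omega (S (k + 1) - curl Omega (u k)) l = 0]]].

End scheme.

(* Main.v *)
Require Import Defs.
From mathcomp Require Import all_boot all_order all_algebra.
From mathcomp Require Import all_classical all_reals all_analysis.
From mathcomp Require Import measurable_realfun ring lra.
Set Implicit Arguments.
Unset Strict Implicit.
Unset Printing Implicit Defensive.
Import Order.TTheory GRing.Theory Num.Theory.
Import numFieldNormedType.Exports.
Local Open Scope classical_set_scope.
Local Open Scope ring_scope.

(** The estimate is the energy identity of the scheme, obtained by testing the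
    momentum equation with the new velocity a = u^(n+1) itself; write b = u^n
    and c = u^(n-1).

    - The BDF2 difference is G-stable: [BDF2_identity] writes 2 (3a - 4b + c, a)
      as the increment of |a|^2 + |2a - b|^2 plus the square |a - 2b + c|^2,
      which is dropped.
    - Convection vanishes by skew-symmetry, and the pressure because a is
      discretely divergence free and p is an admissible test function.
    - S is the L^2 projection onto the large scales of the old curl, so
      |S| <= |curl b|, and Young's inequality gives
      2 (S, curl a) <= |curl b|^2 + |curl a|^2 ([projection_young]). The
      artificial viscosity is thus only partly undone by the S term, and
      what remains is the increment of alpha1 |curl|^2, which telescopes.
    - The load is bounded by |f|_(-1) |grad a| and half of the viscous
      dissipation absorbs it. This is where a factor 2 of the viscous term is
      lost, while the grad-div term keeps it.

    Multiplying by 4 dt gives [energy_step], and summing over the steps gives the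
    theorem.

    Two points are analytic rather than algebraic. Bilinearity of the L^2 inner
    products needs the domain to be measurable, hence that open subsets of R^d
    belong to the product sigma-algebra ([open_measurable_rV]). The bound
    |F v| <= |F|_(-1) |grad v| ([dual_le]) has to be checked also for v = 0
    almost everywhere, over which the supremum does not range; there one needs
    grad v = 0 almost everywhere. As v is in H^1_0, its gradient is an L^2 limit
    of derivatives of test functions, which are test functions again and
    therefore orthogonal to the weak derivative of a null function
    ([wpartial_ae0]). *)

(** * Lebesgue measure on R^n: open sets, bounded sets, continuous functions *)

Section lebesgue_rV_facts.
Variable R : realType.

Lemma measurable_rV_box n (F : 'I_n -> set R) :
  (forall i, measurable (F i)) ->
  measurable [set x : 'rV[R]_n | forall i, F i (x 0 i)].
Proof.
move=> mF.
rewrite (_ : [set x | _] =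
    \bigcap_(i in [set: 'I_n]) ((fun x : 'rV[R]_n => x 0 i) @^-1` F i)).
  apply: fin_bigcap_measurable => [|i _]; first exact: finite_finset.
  rewrite -[X in measurable X]setTI.
  exact: (@measurable_coord R n i measurableT (F i) (mF i)).
by apply/seteqP; split=> [x Fx i _ | x Fx i]; [exact: Fx | exact: (Fx i)].
Qed.

(** An open set is the union of the rational cubes that it contains, and these
    are countably many. *)
Lemma open_measurable_rV n (A : set 'rV[R]_n) : open A -> measurable A.
Proof.
move=> oA.
pose box (q : 'rV[rat]_n) (r : rat) : set 'rV[R]_n :=
  [set y | forall i, ball (ratr (q 0 i) : R) (ratr r) (y 0 i)].
have -> : A = \bigcup_q (\bigcup_r
    if `[< box q r `<=` A >] then box q r else set0).
  apply/seteqP; split=> [x Ax | x [q _ [r _]]]; last first.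
    by case: ifPn => // /asboolP; exact.
  have /nbhs_ballP[e /= e0 xeA] := open_nbhs_nbhs (conj oA Ax).
  have [r] : exists r : rat, (ratr r : R) \in `]0, (e / 2)[.
    by apply: rat_in_itvoo; rewrite divr_gt0.
  rewrite in_itv/= => /andP[r0 re].
  have /choice[q xq] : forall i, exists q : rat,
      ball (x 0 i) (ratr r) (ratr q : R).
    move=> i; have [q] : exists q : rat,
        (ratr q : R) \in `](x 0 i - ratr r), (x 0 i + ratr r)[.
      by apply: rat_in_itvoo; lra.
    by rewrite in_itv/= => xqr; exists q; rewrite /ball/= ltr_distlC.
  exists (\row_i q i) => //; exists r => //.
  case: ifPn => [_ i | /asboolP[]]; first by rewrite mxE; exact/ball_sym.
  move=> y qry; apply: xeA; split=> // i j; rewrite (ord1 i).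
  (* y and x are both within r of the rational centre q, and 2 r < e. *)
  apply: (@le_ball _ _ _ (ratr r + ratr r)); first by lra.
  by apply: ball_triangle (xq j) _; have := qry j; rewrite mxE.
apply: countable_bigcupT_measurable => [|q]; first exact: countableP.
apply: bigcupT_measurable_rat => r.
case: ifP => // _.
apply: (measurable_rV_box (F := fun i => ball (ratr (q 0 i) : R) (ratr r))) => i.
exact: measurable_ball.
Qed.

Definition cube n (M : R) : set 'rV[R]_n :=
  [set x | forall i, x 0 i \in `[- M, M]].

Arguments cube : clear implicits.

Lemma measurable_cube n (M : R) : measurable (cube n M).
Proof. by apply: (measurable_rV_box (F := fun=> [set` `[- M, M]])) => i. Qed.

(** Finiteness comes by induction on the dimension because the measure is an
    iterated product and a cube is a product of intervals. *)
Lemma lebesgue_rV_cube_fin n (M : R) : (lebesgue_rV R n (cube n M) < +oo)%E.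
Proof.
elim: n => [|n IHn] /=.
  by rewrite diracE; case: (_ \in _); rewrite ltry.
rewrite /lebesgue_step /pushforward.
rewrite (_ : _ @^-1` _ = [set` `[(- M)%R, M]] `*` cube n M).
  rewrite product_measure1E//; last exact: measurable_cube.
  have fM : (@lebesgue_measure R [set` `[(- M)%R, M]] < +oo)%E.
    by rewrite lebesgue_measure_itv/=; case: ifP; rewrite -?EFinB ltry.
  by rewrite lte_mul_pinfty// ge0_fin_numE.
apply/seteqP; split=> [[a x] /= Bx | [a x] /= [Ba Bx] i].
  split=> [|i]; first by have := Bx ord0; rewrite mxE unlift_none.
  by have := Bx (lift ord0 i); rewrite mxE liftK.
rewrite mxE; case: unliftP => [j _|_] /=; [exact: Bx | exact: Ba].
Qed.

Lemma lebesgue_rV_bounded_fin n (A : set 'rV[R]_n) :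
  measurable A -> bounded_set A -> (lebesgue_rV R n A < +oo)%E.
Proof.
move=> mA [M [_ AM]]; have {}AM := AM (M + 1) ltac:(lra).
apply: le_lt_trans (lebesgue_rV_cube_fin _ (M + 1)).
apply: le_measure; rewrite ?inE//; first exact: measurable_cube.
move=> x /AM /= xM i; rewrite in_itv/= -ler_norml.
apply: le_trans xM; rewrite [leRHS]mx_normrE.
exact: (le_bigmax _ (fun ij : 'I_1 * 'I_n => `|x ij.1 ij.2|) (0, i)).
Qed.

Lemma continuous_measurable_fun_rV n (phi : 'rV[R]_n -> R) :
  continuous phi -> measurable_fun setT phi.
Proof.
move=> /continuousP cphi _.
apply: (measurability _ (RGenOpens.measurableE R)) => //.
move=> _ [_ [a [b ->] <-]]; rewrite setTI; apply: open_measurable_rV.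
exact/cphi/interval_open.
Qed.

End lebesgue_rV_facts.

(** * The L^2 inner products *)

Section L2_inner_product.
Variables (R : realType) (d : nat) (Omega : set 'rV[R]_d).
Hypothesis mOmega : measurable Omega.
Local Notation mu := (lebesgue_rV R d).
Implicit Types f g h : 'rV[R]_d -> R.

(** |f g| <= f^2 + g^2 dominates the product. *)
Lemma L2_integrableM f g : L2 Omega f -> L2 Omega g ->
  mu.-integrable Omega (EFin \o (fun x => f x * g x)).
Proof.
move=> [mf if2] [mg ig2].
apply: (@le_integrable _ _ _ mu Omega mOmega _
  (fun x => (f x ^+ 2)%:E + (g x ^+ 2)%:E)%E); last exact: integrableD.
  exact/measurable_EFinP/measurable_funM.
move=> x _ /=; rewrite lee_fin normrM [leRHS]ger0_norm ?addr_ge0 ?sqr_ge0//.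
rewrite -(real_normK (num_real (f x))) -(real_normK (num_real (g x))).
nra.
Qed.

Lemma L2D f g : L2 Omega f -> L2 Omega g -> L2 Omega (fun x => f x + g x).
Proof.
move=> Lf Lg; have [[mf if2] [mg ig2]] := (Lf, Lg); split.
  exact: measurable_funD.
have := integrableD mOmega (integrableD mOmega if2 ig2)
  (integrableZl mOmega 2 (L2_integrableM Lf Lg)).
apply: eq_integrable => // x _ /=; rewrite -EFinM -!EFinD.
by congr EFin; ring.
Qed.

Lemma L2Z (c : R) f : L2 Omega f -> L2 Omega (fun x => c * f x).
Proof.
move=> [mf if2]; split; first exact: measurable_funM.
have := integrableZl mOmega (c ^+ 2) if2.
by apply: eq_integrable => // x _ /=; rewrite -EFinM exprMn.
Qed.

Lemma L2B f g : L2 Omega f -> L2 Omega g -> L2 Omega (fun x => f x - g x).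
Proof.
move=> Lf /(L2Z (-1)) /(L2D Lf).
by under eq_fun do rewrite mulN1r.
Qed.

Lemma L2ipC f g : L2ip Omega f g = L2ip Omega g f.
Proof. by apply: eq_Rintegral => x _; rewrite mulrC. Qed.

Lemma L2ip_ge0 f : 0 <= L2ip Omega f f.
Proof. by apply: Rintegral_ge0 => x _; rewrite -expr2 sqr_ge0. Qed.

Lemma L2normK f : L2norm Omega f ^+ 2 = L2ip Omega f f.
Proof. by rewrite sqr_sqrtr// L2ip_ge0. Qed.

Lemma L2ipDl f g h : L2 Omega f -> L2 Omega g -> L2 Omega h ->
  L2ip Omega (fun x => f x + g x) h = L2ip Omega f h + L2ip Omega g h.
Proof.
move=> Lf Lg Lh; rewrite -RintegralD//; last 2 first.
- exact: L2_integrableM.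
- exact: L2_integrableM.
by apply: eq_Rintegral => x _; rewrite mulrDl.
Qed.

Lemma L2ipZl (c : R) f h : L2 Omega f -> L2 Omega h ->
  L2ip Omega (fun x => c * f x) h = c * L2ip Omega f h.
Proof.
move=> Lf Lh; rewrite -RintegralZl//; last exact: L2_integrableM.
by apply: eq_Rintegral => x _; rewrite mulrA.
Qed.

Lemma L2ipBl f g h : L2 Omega f -> L2 Omega g -> L2 Omega h ->
  L2ip Omega (fun x => f x - g x) h = L2ip Omega f h - L2ip Omega g h.
Proof.
move=> Lf Lg Lh; rewrite -RintegralB//; last 2 first.
- exact: L2_integrableM.
- exact: L2_integrableM.
by apply: eq_Rintegral => x _; rewrite mulrBl.
Qed.

Section mx.
Variables m n : nat.
Implicit Types F G H : 'rV[R]_d -> 'M[R]_(m, n).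

Lemma L2_mxD F G : L2_mx Omega F -> L2_mx Omega G -> L2_mx Omega (F + G).
Proof.
move=> LF LG i j; have := L2D (LF i j) (LG i j).
by congr L2; apply/funext => x; rewrite mxE.
Qed.

Lemma L2_mxZ (c : R) F : L2_mx Omega F -> L2_mx Omega (c *: F).
Proof.
move=> LF i j; have := L2Z c (LF i j).
by congr L2; apply/funext => x; rewrite mxE.
Qed.

Lemma L2_mxB F G : L2_mx Omega F -> L2_mx Omega G -> L2_mx Omega (F - G).
Proof.
by move=> LF /(L2_mxZ (-1)); rewrite scaleN1r; exact: L2_mxD.
Qed.

Lemma L2ip_mxE F G : L2_mx Omega F -> L2_mx Omega G ->
  L2ip_mx Omega F G =
  \sum_i \sum_j L2ip Omega (fun x => F x i j) (fun x => G x i j).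
Proof.
move=> LF LG; have iFG i j := L2_integrableM (LF i j) (LG i j).
rewrite pair_bigA /L2ip_mx /Rintegral.
under eq_integral do rewrite pair_bigA -sumEFin/=.
rewrite (@integral_sum _ _ _ mu Omega mOmega _
  (fun p x => (F x p.1 p.2 * G x p.1 p.2)%:E)).
  by rewrite sum_fine// => p _; exact/integrable_fin_num/iFG.
by move=> p; exact: iFG.
Qed.

Lemma L2ip_mxC F G : L2ip_mx Omega F G = L2ip_mx Omega G F.
Proof.
apply: eq_Rintegral => x _; apply: eq_bigr => i _; apply: eq_bigr => j _.
by rewrite mulrC.
Qed.

Lemma L2ip_mx_ge0 F : 0 <= L2ip_mx Omega F F.
Proof.
apply: Rintegral_ge0 => x _; apply: sumr_ge0 => i _; apply: sumr_ge0 => j _.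
by rewrite -expr2 sqr_ge0.
Qed.

Lemma L2norm_mxK F : L2norm_mx Omega F ^+ 2 = L2ip_mx Omega F F.
Proof. by rewrite sqr_sqrtr// L2ip_mx_ge0. Qed.

Lemma L2ip_mxDl F G H : L2_mx Omega F -> L2_mx Omega G -> L2_mx Omega H ->
  L2ip_mx Omega (F + G) H = L2ip_mx Omega F H + L2ip_mx Omega G H.
Proof.
move=> LF LG LH; rewrite !L2ip_mxE//; last exact: L2_mxD.
rewrite -big_split; apply: eq_bigr => i _; rewrite -big_split/=.
apply: eq_bigr => j _; rewrite -L2ipDl//.
by congr L2ip; apply/funext => x; rewrite mxE.
Qed.

Lemma L2ip_mxZl (c : R) F H : L2_mx Omega F -> L2_mx Omega H ->
  L2ip_mx Omega (c *: F) H = c * L2ip_mx Omega F H.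
Proof.
move=> LF LH; rewrite !L2ip_mxE//; last exact: L2_mxZ.
rewrite mulr_sumr; apply: eq_bigr => i _; rewrite mulr_sumr.
apply: eq_bigr => j _; rewrite -L2ipZl//.
by congr L2ip; apply/funext => x; rewrite mxE.
Qed.

Lemma L2ip_mxBl F G H : L2_mx Omega F -> L2_mx Omega G -> L2_mx Omega H ->
  L2ip_mx Omega (F - G) H = L2ip_mx Omega F H - L2ip_mx Omega G H.
Proof.
move=> LF LG LH; rewrite -scaleN1r L2ip_mxDl//; last exact: L2_mxZ.
by rewrite L2ip_mxZl// mulN1r.
Qed.

Lemma L2norm_mx_sqB F G : L2_mx Omega F -> L2_mx Omega G ->
  L2norm_mx Omega (F - G) ^+ 2 =
  L2norm_mx Omega F ^+ 2 - 2 * L2ip_mx Omega F G + L2norm_mx Omega G ^+ 2.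
Proof.
move=> LF LG; have LFG := L2_mxB LF LG.
rewrite !L2norm_mxK L2ip_mxBl// ![L2ip_mx _ _ (F - G)]L2ip_mxC !L2ip_mxBl//.
by rewrite (L2ip_mxC G F); ring.
Qed.

End mx.

(** G-stability of the second order backward difference: tested with its newest
    argument it is the increment of a positive quadratic form plus a square. *)
Lemma BDF2_identity m n (a b c : 'rV[R]_d -> 'M[R]_(m, n)) :
  L2_mx Omega a -> L2_mx Omega b -> L2_mx Omega c ->
  2 * L2ip_mx Omega (3 *: a - 4 *: b + c) a =
  L2norm_mx Omega a ^+ 2 + L2norm_mx Omega (2 *: a - b) ^+ 2
  - (L2norm_mx Omega b ^+ 2 + L2norm_mx Omega (2 *: b - c) ^+ 2)
  + L2norm_mx Omega (a - (2 *: b - c)) ^+ 2.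
Proof.
move=> La Lb Lc.
have [La2 Lb2] := (L2_mxZ 2 La, L2_mxZ 2 Lb).
have [La3 Lb4] := (L2_mxZ 3 La, L2_mxZ 4 Lb).
have Lbc := L2_mxB Lb2 Lc.
rewrite (L2ip_mxDl (L2_mxB La3 Lb4))// L2ip_mxBl//.
rewrite (L2norm_mx_sqB La Lbc) (L2norm_mx_sqB La2 Lb) (L2norm_mx_sqB Lb2 Lc).
rewrite (L2ip_mxC a (_ - _)) L2ip_mxBl// !L2norm_mxK.
rewrite !L2ip_mxZl// (L2ip_mxC b (2 *: b)) (L2ip_mxC a (2 *: a)).
rewrite !L2ip_mxZl// (L2ip_mxC b a).
by ring.
Qed.

(** Orthogonality of [S - c0] to [S] alone already gives |S| <= |c0|. Expanding
    the squares of S - c0 and S - c1 yields that bound and Young's inequality at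
    once, with no Cauchy-Schwarz inequality. *)
Lemma projection_young m n (S c0 c1 : 'rV[R]_d -> 'M[R]_(m, n)) :
  L2_mx Omega S -> L2_mx Omega c0 -> L2_mx Omega c1 ->
  L2ip_mx Omega (S - c0) S = 0 ->
  2 * L2ip_mx Omega S c1 <= L2norm_mx Omega c0 ^+ 2 + L2norm_mx Omega c1 ^+ 2.
Proof.
move=> LS L0 L1; rewrite L2ip_mxBl// -L2norm_mxK (L2ip_mxC c0) => S0.
have := sqr_ge0 (L2norm_mx Omega (S - c0)).
have := sqr_ge0 (L2norm_mx Omega (S - c1)).
by rewrite !L2norm_mx_sqB//; lra.
Qed.

End L2_inner_product.

(** * Weak derivatives and the dual norm *)

Section weak_derivatives.
Variables (R : realType) (d : nat) (Omega : set 'rV[R]_d).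
Hypotheses (mOmega : measurable Omega) (bOmega : bounded_set Omega).
Local Notation E := 'rV[R]_d.
Local Notation mu := (lebesgue_rV R d).
Implicit Types (phi u : E -> R) (v : E -> E).

Lemma wpartialP i u : H1 Omega u ->
  is_weak_partial Omega i u (wpartial Omega i u).
Proof. by move=> [_ /(_ i) /(xgetPex (fun=> 0))]. Qed.

(** The support does not grow: off the closed set K the function vanishes in a
    whole neighbourhood. *)
Lemma test_function_partial i phi :
  test_function Omega phi -> test_function Omega (partial i phi).
Proof.
move=> [sphi [K [cK KO phi0]]]; split.
  by move=> s; have := sphi (rcons s i); rewrite foldr_rcons.
exists K; split=> // x nKx; rewrite /partial.
rewrite (@near_eq_derive _ _ _ phi (cst 0)) ?derive_cst//.
have oK : open (~` K).
  by apply: closed_openC; apply: compact_closed cK; exact: norm_hausdorff.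
by near=> y; apply: phi0; near: y; exact: open_nbhs_nbhs.
Unshelve. all: by end_near. Qed.

(** A continuous function with compact support is bounded, and a bounded domain
    has finite measure. *)
Lemma test_function_L2 phi : test_function Omega phi -> L2 Omega phi.
Proof.
move=> [/(_ [::]) [/= cphi _] [K [cK KO phi0]]].
have mphi : measurable_fun Omega phi.
  by apply: measurable_funTS; apply: continuous_measurable_fun_rV; exact: cphi.
have [M [_ phiM]] : bounded_set (phi @` K).
  by apply: compact_bounded; apply: continuous_compact => //;
    exact: continuous_subspaceT.
have {}phiM x : `|phi x| <= `|M| + 1.
  have [Kx|/phi0 ->] := pselect (K x); last by rewrite normr0 addr_ge0.
  by apply: phiM; [have := ler_norm M; lra | exists x].
split=> //; apply: (measurable_bounded_integrable mOmega).
- exact: lebesgue_rV_bounded_fin.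
- exact: measurable_funX.
- exists ((`|M| + 1) ^+ 2); split; first exact: num_real.
  move=> y My x _ /=; rewrite normrX (le_trans _ (ltW My))//.
  by rewrite lerXn2r// nnegrE// addr_ge0.
Qed.

(** For test functions phi_k tending to u in H^1, the weak derivative g of u is
    orthogonal to d phi_k, because (g, d phi_k) = - (u, d d phi_k) = 0. By
    Pythagoras |g| <= |g - d phi_k|, and the right-hand side tends to 0. *)
Lemma wpartial_ae0 i u : H10 Omega u ->
  {ae mu, forall x, Omega x -> u x = 0} ->
  L2ip Omega (wpartial Omega i u) (wpartial Omega i u) = 0.
Proof.
move=> [Hu [phi [tphi _ /(_ i) gphi]]] u0.
have [Lg gP] := wpartialP i Hu; set g := wpartial Omega i u in Lg gP gphi *.
have tdphi k := test_function_partial i (tphi k).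
have g_orth k : L2ip Omega g (partial i (phi k)) = 0.
  apply/eqP; rewrite -oppr_eq0 -gP//; apply/eqP.
  have [[mOu _] _] := Hu.
  have [mpsi _] := test_function_L2 (test_function_partial i (tdphi k)).
  rewrite /L2ip /Rintegral (@ae_eq_integral _ _ _ mu Omega (cst 0%E))
    ?integral_cst//.
  - by rewrite mul0e.
  - exact/measurable_EFinP/measurable_funM.
  - by apply: filterS u0 => x ux Ox; rewrite ux// mul0r.
have g_le k : L2norm Omega g <=
    L2norm Omega (fun x => g x - partial i (phi k) x).
  have Ldphi := test_function_L2 (tdphi k).
  have Lgd := L2B mOmega Lg Ldphi; apply: ler_wsqrtr.
  have gdl h : L2 Omega h -> L2ip Omega (fun x => g x - partial i (phi k) x) h =
      L2ip Omega g h - L2ip Omega (partial i (phi k)) h by exact: L2ipBl.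
  rewrite gdl// (L2ipC Omega g) (L2ipC Omega (partial i (phi k))) !gdl//.
  rewrite (L2ipC Omega _ g) g_orth.
  by have := L2ip_ge0 Omega (partial i (phi k)); lra.
suff g0 : L2norm Omega g <= 0.
  rewrite -L2normK (_ : L2norm Omega g = 0) ?expr0n//.
  by apply/le_anti; rewrite g0 sqrtr_ge0.
by apply: (cvgr_to_ge gphi); apply: nearW.
Qed.

Lemma L2_wpartial_velocity i j v : velocity_space Omega v ->
  L2 Omega (wpartial Omega i (fun y => v y 0 j)).
Proof. by move=> /(_ j) [/(wpartialP i)[]]. Qed.

Lemma L2_mx_grad v : velocity_space Omega v -> L2_mx Omega (grad Omega v).
Proof.
move=> Vv i j; have := L2_wpartial_velocity i j Vv.
by congr L2; apply/funext => x; rewrite mxE.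
Qed.

Lemma L2_mx_velocity v : velocity_space Omega v -> L2_mx Omega v.
Proof. by move=> Vv i j; rewrite (ord1 i); have [[]] := Vv j. Qed.

Lemma grad_ae0 v : velocity_space Omega v ->
  ~ nonzero_on Omega v -> L2norm_mx Omega (grad Omega v) = 0.
Proof.
move=> Vv /contrapT v0; have Lv := L2_mx_grad Vv.
rewrite /L2norm_mx L2ip_mxE// big1 ?sqrtr0// => i _; rewrite big1// => j _.
rewrite (_ : (fun x => grad Omega v x i j) =
    wpartial Omega i (fun y => v y 0 j)).
  by apply: wpartial_ae0 (Vv j) _; apply: filterS v0 => x vx Ox; rewrite vx// mxE.
by apply/funext => x; rewrite mxE.
Qed.

(** The supremum defining the dual norm ranges over the [v] that do not vanish
    almost everywhere; for the others, the boundedness of [F] and [grad_ae0] give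
    F v = 0. *)
Lemma dual_le (F : (E -> E) -> R) v : dual Omega F -> velocity_space Omega v ->
  `|F v| <= dual_norm Omega F * L2norm_mx Omega (grad Omega v).
Proof.
move=> [_ [C FC]] Vv.
have [nv|/(grad_ae0 Vv) v0] := pselect (nonzero_on Omega v); last first.
  by have := FC v Vv; rewrite v0 !mulr0.
(* By convention the quotient is 0 when the gradient vanishes, so the supremum
   says nothing there; boundedness of F does. *)
have [v0|vn0] := eqVneq (L2norm_mx Omega (grad Omega v)) 0.
  by have := FC v Vv; rewrite v0 !mulr0.
rewrite -ler_pdivrMr ?lt_def ?vn0 ?sqrtr_ge0//.
apply: ub_le_sup; last by exists v.
exists `|C| => _ [w [Vw _] <-].
have [->|wn0] := eqVneq (L2norm_mx Omega (grad Omega w)) 0.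
  by rewrite invr0 mulr0.
have w0 : 0 < L2norm_mx Omega (grad Omega w) by rewrite lt_def wn0 sqrtr_ge0.
rewrite ler_pdivrMr//; apply: le_trans (FC w Vw) _.
by rewrite ler_wpM2r ?ler_norm ?ltW.
Qed.

End weak_derivatives.

Lemma L2_mx_curl (R : realType) d (Omega : set 'rV[R]_d)
    (v : 'rV[R]_d -> 'rV[R]_d) :
  measurable Omega -> velocity_space Omega v -> L2_mx Omega (curl Omega v).
Proof.
move=> mOmega Vv; have := fun i j => L2_wpartial_velocity i j Vv.
move: Omega v mOmega {Vv}; case: d => [|[|[|[|d]]]] Omega v mOmega Lv i j.
1,2,5: by case: j.
- have := L2B mOmega (Lv 0 1) (Lv 1 0).
  by congr L2; apply/funext => x; rewrite mxE.
- have := L2B mOmega (Lv (j + 1 : 'I_3) (j + 2 : 'I_3))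
    (Lv (j + 2 : 'I_3) (j + 1 : 'I_3)).
  by congr L2; apply/funext => x; rewrite mxE.
Qed.

(** * The energy estimate *)

Section energy.
Variables (R : realType) (d : nat) (Omega : set 'rV[R]_d).
Hypotheses (mOmega : measurable Omega) (bOmega : bounded_set Omega).
Local Notation E := 'rV[R]_d.

Lemma trilinear_skew (w v : E -> E) : trilinear Omega w v v = 0.
Proof. by rewrite /trilinear subrr mulr0. Qed.

Definition energy (alpha dt : R) (b c : E -> E) : R :=
  L2norm_mx Omega b ^+ 2 + L2norm_mx Omega (2 *: b - c) ^+ 2
  + 2 * alpha * dt * L2norm_mx Omega (curl Omega b) ^+ 2.

(** One time step. The factor 4 dt clears the denominator 2 dt of the difference
    quotient and produces the factor 2 of [BDF2_identity]. *)
Lemma energy_step (nu alpha1 alpha2 dt : R) (a b c : E -> E) (p : E -> R)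
    (S : E -> 'rV[R]_(curl_dim d)) (F : (E -> E) -> R) :
  0 < nu -> 0 <= alpha1 -> 0 < dt ->
  velocity_space Omega a -> velocity_space Omega b -> velocity_space Omega c ->
  L2_mx Omega S -> dual Omega F ->
  L2ip_mx Omega ((2 * dt)^-1 *: (3 *: a - 4 *: b + c)) a
  + nu * L2ip_mx Omega (grad Omega a) (grad Omega a)
  + trilinear Omega (2 *: b - c) a a
  - L2ip Omega p (div Omega a)
  + alpha1 * L2ip_mx Omega (curl Omega a) (curl Omega a)
  - alpha1 * L2ip_mx Omega S (curl Omega a)
  + alpha2 * L2ip Omega (div Omega a) (div Omega a) = F a ->
  L2ip Omega (div Omega a) p = 0 ->
  L2ip_mx Omega (S - curl Omega b) S = 0 ->
  energy alpha1 dt a b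
  + 2 * dt * (nu * L2norm_mx Omega (grad Omega a) ^+ 2
              + 2 * alpha2 * L2norm Omega (div Omega a) ^+ 2)
  <= energy alpha1 dt b c + 2 * dt * (nu^-1 * dual_norm Omega F ^+ 2).
Proof.
move=> nu0 alpha0 dt0 Va Vb Vc LS dF.
have [La Lb Lc] := And3 (L2_mx_velocity Va)
  (L2_mx_velocity Vb) (L2_mx_velocity Vc).
rewrite trilinear_skew L2ipC => + p0; rewrite p0.
rewrite L2ip_mxZl//; last first.
  by apply: L2_mxD => //; apply: L2_mxB => //; exact: L2_mxZ.
have := BDF2_identity mOmega La Lb Lc.
rewrite -!L2norm_mxK -L2normK; set X := L2ip_mx Omega (_ + c) a => X2 eqF S0.
have := projection_young mOmega LS (L2_mx_curl mOmega Vb)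
  (L2_mx_curl mOmega Va) S0.
move=> /(ler_wpM2l (mulr_ge0 (ltW dt0) alpha0)) young.
have := le_trans (ler_norm _) (dual_le mOmega bOmega dF Va).
have {eqF} := congr1 (fun y => 4 * dt * y) eqF.
have := sqr_ge0 (L2norm_mx Omega (a - (2 *: b - c))).
rewrite /energy.
set G := L2norm_mx Omega (grad Omega a); set D := dual_norm Omega F.
move=> q0 eqF FDG.
have : F a <= 2^-1 * (nu * G ^+ 2 + nu^-1 * D ^+ 2).
  apply: le_trans FDG _; rewrite -subr_ge0.
  (* Young's inequality with weight nu, as a completed square. *)
  rewrite (_ : _ - _ = 2^-1 * (nu * (G - nu^-1 * D) ^+ 2)).
    by rewrite mulr_ge0 ?invr_ge0// mulr_ge0 ?sqr_ge0// ltW.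
  by field; rewrite gt_eqF.
move=> /(ler_wpM2l (ltW dt0)) {}FDG.
have X4 : 4 * dt * ((2 * dt)^-1 * X) = 2 * X by field; rewrite gt_eqF.
move: eqF; rewrite !(mulrDr (4 * dt)) X4 X2.
by lra.
Qed.

End energy.

Lemma nodal_interpolant_fe (R : realType) (V : lmodType R) (S : fe_space V)
    (v : V) :
  fe_set S (nodal_interpolant S v).
Proof.
by exists (\row_i fe_node S i v) => //; apply: eq_bigr => i _; rewrite mxE.
Qed.

Unset Implicit Arguments.

Theorem lemma5p1 (R : realType) (d : nat) (hd : d = 2%N \/ d = 3%N)
  (Omega : set 'rV[R]_d) (hOmega : regular_domain Omega)
  (nu alpha1 alpha2 : R) (hnu : 0 < nu) (halpha1 : 0 < alpha1)
  (halpha2 : 0 < alpha2)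
  (mesh_sizes : set R) (hmesh : forall h, mesh_sizes h -> 0 < h)
  (Xh : R -> fe_space ('rV[R]_d -> 'rV[R]_d))
  (Qh : R -> fe_space ('rV[R]_d -> R))
  (hXh : forall h, mesh_sizes h -> fe_set (Xh h) `<=` velocity_space Omega)
  (hQh : forall h, mesh_sizes h -> fe_set (Qh h) `<=` pressure_space Omega)
  (beta : R) (hbeta : 0 < beta)
  (hinfsup : forall h, mesh_sizes h ->
    (beta%:E <= infsup Omega (fe_set (Xh h)) (fe_set (Qh h)))%E)
  (LH : set ('rV[R]_d -> 'rV[R]_(curl_dim d)))
  (hLH : finite_dim_subspace LH) (hLH2 : forall l, LH l -> L2_mx Omega l)
  (T : R) (hT : 0 < T) (N : nat) (hN : (1 <= N)%N)
  (dt : R) (hdt : dt = T / N%:R)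
  (f : R -> ('rV[R]_d -> 'rV[R]_d) -> R) (hf : Linfty_dual Omega T f)
  (hfn : forall n, (n < N)%N -> dual Omega (f (n.+1%:R * dt)))
  (h : R) (hh : mesh_sizes h) (u0 : 'rV[R]_d -> 'rV[R]_d)
  (u : int -> 'rV[R]_d -> 'rV[R]_d) (p : int -> 'rV[R]_d -> R)
  (S : int -> 'rV[R]_d -> 'rV[R]_(curl_dim d))
  (hsol : SAV_BDF2LE Omega nu alpha1 alpha2 dt N f (Xh h) (Qh h) LH u0 u p S) :
  L2norm_mx Omega (u N%:Z) ^+ 2
  + L2norm_mx Omega (2 *: u N%:Z - u (N%:Z - 1)) ^+ 2
  + 2 * dt * (\sum_(1 <= n < N)
      (nu * L2norm_mx Omega (grad Omega (u (n%:Z + 1))) ^+ 2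
       + 2 * alpha2 * L2norm Omega (div Omega (u (n%:Z + 1))) ^+ 2))
  + 2 * alpha1 * dt * L2norm_mx Omega (curl Omega (u N%:Z)) ^+ 2
  <= L2norm_mx Omega (u 1) ^+ 2 + L2norm_mx Omega (2 *: u 1 - u 0) ^+ 2
  + 2 * alpha1 * dt * L2norm_mx Omega (curl Omega (u 1)) ^+ 2
  + 2 * dt * (\sum_(1 <= n < N)
      nu^-1 * dual_norm Omega (f (n.+1%:R * dt)) ^+ 2).

Proof.
have [_ oOmega _ bOmega _] := hOmega.
have mOmega := open_measurable_rV oOmega.
have [u0E _ scheme] := hsol.
have natS (n : nat) : n.+1%:Z = n%:Z + 1 by rewrite -addn1 PoszD.
have Vu n : (n <= N)%N -> velocity_space Omega (u n%:Z).
  move=> nN; apply: (hXh h hh); case: n nN => [_|n nN].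
    by rewrite u0E; exact: nodal_interpolant_fe.
  by have [+ _ _ _] := scheme n nN; rewrite natS.
have dt0 : 0 < dt by rewrite hdt divr_gt0// ltr0n.
have step n (k := n.+1%:Z) : (n.+1 < N)%N ->
    energy Omega alpha1 dt (u (k + 1)) (u k)
    + 2 * dt * (nu * L2norm_mx Omega (grad Omega (u (k + 1))) ^+ 2
                + 2 * alpha2 * L2norm Omega (div Omega (u (k + 1))) ^+ 2)
    <= energy Omega alpha1 dt (u k) (u (k - 1))
       + 2 * dt * (nu^-1 * dual_norm Omega (f (n.+2%:R * dt)) ^+ 2).
  move=> nN; have [Xu Qp LS [momentum mass proj]] := scheme n.+1 nN.
  have k1 : k - 1 = n%:Z by rewrite /k natS addrK.
  apply: (energy_step mOmega bOmega hnu (ltW halpha1) dt0 (hXh h hh _ Xu)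
    (Vu n.+1 (ltnW nN)) _ (hLH2 _ LS) (hfn _ nN) (momentum _ Xu) (mass _ Qp)
    (proj _ LS)).
  by rewrite -/k k1; apply: Vu; rewrite ltnW// ltnW.
have main m : (m < N)%N ->
    energy Omega alpha1 dt (u m.+1%:Z) (u (m.+1%:Z - 1))
    + 2 * dt * (\sum_(1 <= n < m.+1)
      (nu * L2norm_mx Omega (grad Omega (u (n%:Z + 1))) ^+ 2
       + 2 * alpha2 * L2norm Omega (div Omega (u (n%:Z + 1))) ^+ 2))
    <= energy Omega alpha1 dt (u 1) (u 0)
       + 2 * dt * (\sum_(1 <= n < m.+1)
           nu^-1 * dual_norm Omega (f (n.+1%:R * dt)) ^+ 2).
  elim: m => [_|m IHm mN].
    by rewrite !big_geq// subrr.
  have := IHm (ltnW mN); have := step m mN.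
  rewrite !(big_nat_recr m.+1)//=.
  rewrite (natS m.+1).
  by rewrite addrK !(mulrDr (2 * dt)); lra.
have := main N.-1; rewrite prednK// leqnn => /(_ isT).
by rewrite /energy; lra.
Qed.
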